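(* Let $\mathscr{H}$ be a complex Hilbert space, let $V$ be a Hilbert $\mathbb{K}(\mathscr{H})$-module and let $x, y\in V$. Then the following statements are equivalent: (i) $x\perp_B y$. (ii) There exists a positive trace-class operator $P\in\mathcal{C}_1(\mathscr{H})$ of trace one such that $$\|x + \lambda y\|^2 \geq \|x\|^2 + |\lambda|^2\,\mathrm{tr}(P|y|^2) \qquad \text{for all } \lambda\in\mathbb{C}.$$
   Context: Hilbert spaces are complex and nonzero. $\mathbb{K}(\mathscr{H})$ is the $C^*$-algebra of compact operators on $\mathscr{H}$, and $\mathcal{C}_1(\mathscr{H})$ is the algebra of trace-class operators on $\mathscr{H}$. A Hilbert $\mathscr{A}$-module over a $C^*$-algebra $\mathscr{A}$ is a right $\mathscr{A}$-module $V$ with an $\mathscr{A}$-valued inner product $\langle\cdot,\cdot\rangle$ (conjugate-linear in the first variable, $\mathscr{A}$-linear in the second), complete in the norm $\|x\|=\|\langle x,x\rangle\|^{1/2}$. For $y \in V$, $|y|$ is the positive square root of $\langle y,y\rangle$, so $|y|^2=\langle y,y\rangle$. Birkhoff--James orthogonality: $x\perp_B y$ means $\|x+\lambda y\|\ge\|x\|$ for all $\lambda\in\mathbb{C}$. *)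

(* Defs.v *)
From HB Require Import structures.
From mathcomp Require Import all_boot all_order all_algebra sesquilinear.
From mathcomp.real_closed Require Import complex.
From mathcomp Require Import all_classical all_reals all_analysis.
From mathcomp Require analysis.showcase.summability.

Set Implicit Arguments.
Unset Strict Implicit.
Unset Printing Implicit Defensive.
Import Order.TTheory GRing.Theory Num.Theory.
Import numFieldNormedType.Exports.
Local Open Scope classical_set_scope.
Local Open Scope complex_scope.
Local Open Scope ring_scope.

(* [sesquilinear] forms are linear in the first variable and conjugate-linear in
   the second. The zero space is a [hilbertType]. *)
HB.mixin Record isHilbert (R : realType) H of CompleteNormedModule R[i] H := {
  hdot : {dot H for (@Num.conj R[i])} ;
  hdot_norm : forall u : H, hdot u u = `|u| ^+ 2
}.

#[short(type="hilbertType")]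
HB.structure Definition Hilbert (R : realType) :=
  {H of isHilbert R H & CompleteNormedModule R[i] H}.

Section Operators.
Variables (R : realType) (H : hilbertType R).
Implicit Types S T : H -> H.

Definition bounded_op T := linear T /\ continuous T.

Definition compact_op T :=
  bounded_op T /\ precompact (T @` [set u | `|u| <= 1]).

Definition adjoint_of S T := forall u v, hdot (S u) v = hdot u (T v).

(* [<=] on [R[i]] forces the right-hand side to be real here. *)
Definition positive_op T := forall u, 0 <= hdot (T u) u.

Definition opnorm T : R := sup [set complex.Re `|T u| | u in [set u | `|u| <= 1]].

(* [A] is the absolute value of [T], i.e. the positive square root of [T^* T] *)
Definition absolute_value_of A T :=
  [/\ bounded_op A, positive_op A &
      exists2 S, adjoint_of S T & A \o A = S \o T].

Lemma bounded_opD S T : bounded_op S -> bounded_op T -> bounded_op (S + T).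
Proof.
move=> [lS cS] [lT cT]; split.
  by move=> a u v; rewrite !fctE lS lT scalerDr addrACA.
by move=> u; apply: cvgD; [exact: cS|exact: cT].
Qed.

Lemma bounded_opZ (c : R[i]) T : bounded_op T -> bounded_op (c *: T).
Proof.
move=> [lT cT]; split.
  by move=> a u v; rewrite !fctE lT scalerDr !scalerA mulrC.
by move=> u; apply: cvgZr; exact: cT.
Qed.

Lemma bounded_op_comp S T : bounded_op S -> bounded_op T -> bounded_op (S \o T).
Proof.
move=> [lS cS] [lT cT]; split; first by move=> a u v; rewrite /= lT lS.
by move=> u; apply: continuous_comp; [exact: cT|exact: cS].
Qed.

Lemma precompact_image (U W : normedModType R[i]) (f : U -> W) (A : set U) :
  continuous f -> precompact A -> precompact (f @` A).
Proof.
move=> cf [B AB [cB _]]; exists (f @` B).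
  by move=> _ [a Aa <-]; exists a => //; exact: AB.
have cfB : compact (f @` B).
  by apply: continuous_compact cB; exact: continuous_subspaceT.
by split=> //; apply: compact_closed cfB; exact: norm_hausdorff.
Qed.

Lemma compact_op_comp S T : compact_op S -> compact_op T -> compact_op (S \o T).
Proof.
move=> [bS _] [bT kT]; split; first exact: bounded_op_comp.
rewrite -image_comp; apply: precompact_image kT; exact: bS.2.
Qed.

Lemma compact_opZ (c : R[i]) T : compact_op T -> compact_op (c *: T).
Proof.
move=> [bT kT]; split; first exact: bounded_opZ.
have -> : (c *: T) = (fun v => c *: v) \o T by [].
by rewrite -image_comp; apply: precompact_image kT; exact: scaler_continuous.
Qed.

Lemma compact_opD S T : compact_op S -> compact_op T -> compact_op (S + T).
Proof.
move=> [bS [KS sS [cS _]]] [bT [KT sT [cT _]]].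
split; first exact: bounded_opD.
pose add (p : H * H) := p.1 + p.2.
exists (add @` (KS `*` KT)).
  move=> _ [u u1 <-]; exists (S u, T u) => //=.
  by split; [apply: sS; exists u|apply: sT; exists u].
have cK : compact (add @` (KS `*` KT)).
  apply: continuous_compact; last exact: compact_setX.
  by apply: continuous_subspaceT => p; exact: add_continuous.
by split=> //; apply: compact_closed cK; exact: norm_hausdorff.
Qed.

Lemma compact_op0 : compact_op 0.
Proof.
split; first split.
- by move=> a u v; rewrite -![(0 : H -> H) _]/(0 : H) scaler0 addr0.
- by move=> u; exact: cvg_cst.
exists [set 0]; first by move=> _ [u _ <-].
by split; [exact: compact_set1|apply: compact_closed; [exact: norm_hausdorff|exact: compact_set1]].
Qed.

Definition compact_pred : {pred H -> H} := fun T => `[< compact_op T >].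

Lemma compact_predP T : reflect (compact_op T) (T \in compact_pred).
Proof. exact: asboolP. Qed.

Lemma compact_submod_closed : submod_closed compact_pred.
Proof.
split; first exact/compact_predP/compact_op0.
move=> a S T /compact_predP cS /compact_predP cT; apply/compact_predP.
by apply: compact_opD cT; exact: compact_opZ.
Qed.

HB.instance Definition _ :=
  GRing.isSubmodClosed.Build R[i] (H -> H) compact_pred compact_submod_closed.

End Operators.

Record compactOp (R : realType) (H : hilbertType R) := CompactOp {
  compactOp_fun :> H -> H ;
  _ : compactOp_fun \in @compact_pred R H
}.
Arguments CompactOp {R H}.

Section CompactOperators.
Variables (R : realType) (H : hilbertType R).

HB.instance Definition _ := [isSub for @compactOp_fun R H].
HB.instance Definition _ := [Choice of compactOp H by <:].
HB.instance Definition _ := [SubChoice_isSubLmodule of compactOp H by <:].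

Lemma compactOpP (a : compactOp H) : compact_op a.
Proof. exact/compact_predP/(valP a). Qed.

Definition compactOp_mul (a b : compactOp H) : compactOp H :=
  CompactOp (a \o b)
    (introT (compact_predP _) (compact_op_comp (compactOpP a) (compactOpP b))).

End CompactOperators.

(* Conjugate-linearity of [vdot] in the first variable follows from [vdotC], and
   definiteness from [vdot_norm], since [`|_|] is the complete norm of [V]. *)
HB.mixin Record isHilbertKModule (R : realType) (H : hilbertType R) V
    of CompleteNormedModule R[i] V := {
  kact : V -> compactOp H -> V ;
  vdot : V -> V -> compactOp H ;
  actDl : forall x y a, kact (x + y) a = kact x a + kact y a ;
  actDr : forall x a b, kact x (a + b) = kact x a + kact x b ;
  actA : forall x a b, kact (kact x a) b = kact x (compactOp_mul a b) ;
  actZl : forall (c : R[i]) x a, kact (c *: x) a = c *: kact x a ;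
  actZr : forall (c : R[i]) x a, kact x (c *: a) = c *: kact x a ;
  vdotD : forall x y z, vdot x (y + z) = vdot x y + vdot x z ;
  vdotZ : forall (c : R[i]) x y, vdot x (c *: y) = c *: vdot x y ;
  vdotM : forall x y a, vdot x (kact y a) = compactOp_mul (vdot x y) a ;
  vdotC : forall x y, adjoint_of (vdot y x) (vdot x y) ;
  vdot_ge0 : forall x, positive_op (vdot x x) ;
  vdot_norm : forall x : V, `|x| = (Num.sqrt (opnorm (vdot x x)))%:C
}.

#[short(type="hilbertKModule")]
HB.structure Definition HilbertKModule (R : realType) (H : hilbertType R) :=
  {V of isHilbertKModule R H V & CompleteNormedModule R[i] V}.

Section Trace.
Variables (R : realType) (H : hilbertType R).
Implicit Types (T : H -> H) (E : set H).

Definition orthonormal_set E :=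
  forall e f, E e -> E f -> hdot e f = (e == f)%:R.

Definition orthonormal_basis E :=
  orthonormal_set E /\ forall v, (forall e, E e -> hdot v e = 0) -> v = 0.

Lemma exists_orthonormal_basis : exists E, orthonormal_basis E.
Proof.
have [F Fon totF|E [Eon Emax]] := @Zorn_bigcup H orthonormal_set.
  move=> e f [A FA Ae] [B FB Bf].
  by have [sAB|sBA] := totF _ _ FA FB;
    [apply: (Fon B) => //; exact: sAB|apply: (Fon A) => //; exact: sBA].
exists E; split=> // v vE; apply: contrapT => /eqP v0.
have nv0 : `|v| != 0 by rewrite normr_eq0.
pose w := `|v|^-1 *: v.
have ww : hdot w w = 1.
  by rewrite hdot_norm normrZ ger0_norm ?invr_ge0// mulVf// expr1n.
have wE e : E e -> hdot w e = 0.
  by move=> Ee; rewrite /w linearZl_LR /= vE// mulr0.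
have Ew e : E e -> hdot e w = 0.
  by move=> Ee; rewrite hermC/= wE// rmorph0 mulr0.
have nEw : ~ E w by move=> /wE; rewrite ww => /eqP; rewrite oner_eq0.
apply: (Emax (w |` E)).
  split; first by move=> e Ee; right.
  by move=> /(_ w) wEE; apply: nEw; apply: wEE; left.
move=> e f [->|Ee] [->|Ef].
- by rewrite ww eqxx.
- by rewrite wE//; case: eqP => // wf; case: nEw; rewrite wf.
- by rewrite Ew//; case: eqP => // ew; case: nEw; rewrite -ew.
- exact: Eon.
Qed.

(* The trace and the trace class do not depend on the basis chosen here. *)
Definition hbasis : set H := projT1 (cid exists_orthonormal_basis).

(* [hdot (A e) e] is real and nonnegative, so that taking [complex.Re] only changes
   its type. *)
Definition trace_class T :=
  bounded_op T /\ exists2 A, absolute_value_of A T &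
    (\esum_(e in hbasis) (complex.Re (hdot (A e) e))%:E < +oo)%E.

(* The limit of the sums over the finite subsets of [hbasis], ordered by
   inclusion. *)
Definition optrace T : R[i] :=
  summability.sum (fun e : hbasis => hdot (T (val e)) (val e) : R[i]^o).

End Trace.

Definition birkhoff_james (K : numFieldType) (V : normedModType K) (x y : V) :=
  forall c : K, `|x| <= `|x + c *: y|.

(* Main.v *)
Require Import Defs.
From mathcomp Require Import all_boot all_order all_algebra sesquilinear finmap.
From mathcomp.real_closed Require Import complex.
From mathcomp Require Import all_classical all_reals all_analysis.
From mathcomp Require Import ring lra.
From mathcomp Require analysis.showcase.summability.

Set Implicit Arguments.
Unset Strict Implicit.
Unset Printing Implicit Defensive.

Import Order.TTheory GRing.Theory Num.Theory.
Import numFieldNormedType.Exports.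
Local Open Scope classical_set_scope.
Local Open Scope complex_scope.
Local Open Scope ring_scope.

(** Write [A = <x, x>], [B = <x, y>] and [D = <y, y>]; these are compact
    operators, [A] and [D] are positive, and [opnorm A = `|x| ^+ 2].

    Orthogonality gives more than the density operator asked for: there is a
    unit vector [u] with [A u = `|x| ^+ 2 *: u] and [<B u, u> = 0], so that [P]
    can be the rank one projection on [u]. Indeed, for such a [u],
    [`|x + c *: y| ^+ 2 >= <<x + c *: y, x + c *: y> u, u>], and the right-hand
    side expands to [`|x| ^+ 2 + `|c| ^+ 2 * <D u, u>]; Parseval's identity
    ([optrace_parseval]) identifies [<D u, u>] with the trace of [P D].

    If [x = 0], any unit vector will do. Otherwise [u] is found in three steps.
    First, for each complex [c] and each small [t > 0], a vector of the unit
    ball that nearly maximizes the quadratic form of [<x + t c y, x + t c y>]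
    nearly maximizes that of [A], and has [Re (c <B u, u>)] nearly nonnegative,
    since by orthogonality the maximum is at least [`|x| ^+ 2]. Next, since [A]
    is compact, such vectors accumulate at an exact unit eigenvector of [A] with
    [Re (c <B u, u>) >= 0] ([top_eigensphere_attained],
    [birkhoff_james_top_eigenvector]). So on the top eigenspace the numerical
    range of [B] meets every closed half-plane through 0. Finally it
    contains 0 ([numerical_range_top_eigensphere0]): the modulus of [<B u, u>]
    has a minimizer [u0] on the eigensphere, again by compactness; if the
    minimum were not 0, moving [u0] slightly towards a vector [v] whose value
    lies in the opposite half-plane, with a phase that keeps the first-order
    change on the line through 0 and [<B u0, u0>], would decrease it. This is the
    only part of the Toeplitz-Hausdorff theorem that is needed.

    Conversely, the inequality of the statement bounds [`|x + s c y| ^+ 2] below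
    by [`|x| ^+ 2] up to [O(s ^+ 2)], and convexity of the norm along the segment
    ([convex_slope]) then gives [`|x| <= `|x + c y|]. The positivity of the trace
    plays no role in this direction. *)

(** * Inequalities between real polynomials *)

Section RealInequalities.
Variable R : realFieldType.

Lemma discriminant_le0 (a b c : R) :
  (forall t, 0 <= a + 2 * t * b + t ^+ 2 * c) -> 0 <= c -> b ^+ 2 <= a * c.
Proof.
move=> pos c_ge0.
have [c0|c_neq0] := eqVneq c 0.
  have [->|b_neq0] := eqVneq b 0; first by rewrite c0 expr0n mulr0.
  have := pos (- (a + 1) / (2 * b)).
  have -> : a + 2 * (- (a + 1) / (2 * b)) * b + (- (a + 1) / (2 * b)) ^+ 2 * c = - 1.
    by rewrite c0; field.
  by rewrite oppr_ge0 ler10.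
have c_gt0 : 0 < c by rewrite lt_neqAle eq_sym c_neq0.
have := pos (- b / c).
have -> : a + 2 * (- b / c) * b + (- b / c) ^+ 2 * c = (a * c - b ^+ 2) / c.
  by field.
by rewrite pmulr_lge0 ?invr_gt0// subr_ge0.
Qed.

(** A polynomial of degree at most 2 which is positive at 0 is positive just to
    the right of 0. *)
Lemma quadratic_near0_gt0 (a b c : R) : 0 < a ->
  exists2 d, 0 < d & forall t, 0 < t -> t <= d -> 0 < a + t * b + t ^+ 2 * c.
Proof.
move=> a_gt0; have b0 := normr_ge0 b; have c0 := normr_ge0 c.
have D_gt0 : 0 < a + `|b| + `|c| by lra.
exists (Num.min 1 (a / (a + `|b| + `|c|) / 2)) => [|t t_gt0].
  by rewrite lt_min ltr01 !divr_gt0.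
rewrite le_min -mulrA -invfM ler_pdivlMr ?mulr_gt0// => /andP[t1 tD].
have tb : - (t * `|b|) <= t * b by rewrite -mulrN ler_pM2l// lerNl ler_normr lexx orbT.
have tc : - (t * `|c|) <= t ^+ 2 * c.
  have : - (t ^+ 2 * `|c|) <= t ^+ 2 * c.
    by rewrite -mulrN ler_pM2l ?exprn_gt0// lerNl ler_normr lexx orbT.
  apply: le_trans; rewrite lerN2 ler_wpM2r// expr2 ler_piMl// ltW//.
have ta : 0 < t * a by rewrite mulr_gt0.
by lra.
Qed.

(** The left-hand side is the squared modulus of
    [(1 + t * al + t ^+ 2 * k) + i (t ^+ 2 * l)]. The sign of [t] can be chosen
    so that the linear terms favour the right-hand side; the term [ka] then gains
    at order 2, while [l] only enters at order 4. *)
Lemma perturbed_square_lt (al be ka k l : R) : 0 < ka -> k <= 0 ->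
  exists t, (1 + t * al + t ^+ 2 * k) ^+ 2 + (t ^+ 2 * l) ^+ 2 <
            (1 + t * be + t ^+ 2 * ka) ^+ 2.
Proof.
move=> ka_gt0 k_le0.
wlog al_le : al be / al <= be.
  move=> IH; have [/IH//|be_lt] := leP al be.
  have [|t tP] := IH (- al) (- be); first by rewrite lerN2 ltW.
  by exists (- t); rewrite !sqrrN !mulNr -!mulrN.
have [d d_gt0 dP] := @quadratic_near0_gt0 2 (al + be) k (ltr0n _ 2).
have [|e e_gt0 eP] := @quadratic_near0_gt0 (2 * ka) (2 * be * ka) (ka ^+ 2 - l ^+ 2).
  by rewrite mulr_gt0.
pose t := Num.min d e.
have t_gt0 : 0 < t by rewrite lt_min d_gt0.
have {dP} : 0 < 2 + t * (al + be) + t ^+ 2 * k.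
  by apply: dP => //; rewrite ge_min lexx.
have {eP} : 0 < 2 * ka + t * (2 * be * ka) + t ^+ 2 * (ka ^+ 2 - l ^+ 2).
  by apply: eP => //; rewrite ge_min lexx orbT.
move=> E2 E1; exists t.
have t2 : 0 < t ^+ 2 by rewrite exprn_gt0.
have tb : t * al <= t * be by rewrite ler_pM2l.
have tk : t ^+ 2 * k <= 0 by rewrite pmulr_rle0.
have sq : (1 + t * al + t ^+ 2 * k) ^+ 2 <= (1 + t * be) ^+ 2.
  rewrite -subr_ge0 subr_sqr mulr_ge0//; lra.
rewrite -subr_gt0.
have -> : (1 + t * be + t ^+ 2 * ka) ^+ 2 -
    ((1 + t * al + t ^+ 2 * k) ^+ 2 + (t ^+ 2 * l) ^+ 2) =
    t ^+ 2 * (2 * ka + t * (2 * be * ka) + t ^+ 2 * (ka ^+ 2 - l ^+ 2)) +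
    ((1 + t * be) ^+ 2 - (1 + t * al + t ^+ 2 * k) ^+ 2) by ring.
by rewrite ltr_wpDr ?subr_ge0// mulr_gt0.
Qed.

(** [f s] stands for the norm at parameter [s] on the segment from a vector of
    norm [n] to a vector of norm [N]. Convexity turns a lower bound which is
    only good up to order [s ^+ 2] into [n <= N], whatever the sign of [k]. *)
Lemma convex_slope (n N k : R) (f : R -> R) :
  0 <= N -> 0 <= n ->
  (forall s, 0 < s -> s <= 1 -> 0 <= f s) ->
  (forall s, 0 < s -> s <= 1 -> f s <= (1 - s) * n + s * N) ->
  (forall s, 0 < s -> s <= 1 -> n ^+ 2 + s ^+ 2 * k <= f s ^+ 2) ->
  n <= N.
Proof.
move=> N_ge0 n_ge0 f_ge0 f_convex f_ge; rewrite leNgt; apply/negP => Nn.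
have d_gt0 : 0 < n - N by rewrite subr_gt0.
have nd_gt0 : 0 < 2 * n * (n - N) by rewrite !mulr_gt0//; lra.
have [e e_gt0 eP] := quadratic_near0_gt0 (k - (n - N) ^+ 2) 0 nd_gt0.
pose s := Num.min 1 e.
have s_gt0 : 0 < s by rewrite lt_min ltr01.
have s1 : s <= 1 by rewrite ge_min lexx.
have {eP} : 0 < 2 * n * (n - N) + s * (k - (n - N) ^+ 2) + s ^+ 2 * 0.
  by apply: eP => //; rewrite ge_min lexx orbT.
rewrite mulr0 addr0 -(pmulr_rgt0 _ s_gt0) => pos.
have : f s ^+ 2 <= ((1 - s) * n + s * N) ^+ 2.
  by rewrite ler_sqr ?nnegrE ?f_convex// ?f_ge0// addr_ge0 ?mulr_ge0 ?subr_ge0// ltW.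
have := f_ge s s_gt0 s1; nra.
Qed.

End RealInequalities.

(** * The underlying real inner product space *)

Section RealInnerProduct.
Variables (R : realType) (H : hilbertType R).
Implicit Types (u v w : H) (c : R[i]) (t : R).

(** The real part of the inner product, and the norm as a real number. *)
Definition rdot u v : R := complex.Re (hdot u v).
Definition rnorm u : R := complex.Re `|u|.

Lemma normE u : `|u| = (rnorm u)%:C.
Proof. by rewrite /rnorm RRe_real// normr_real. Qed.

Lemma rnorm_ge0 u : 0 <= rnorm u.
Proof. by rewrite -ler0c -normE. Qed.

Lemma hdotC u v : hdot u v = (hdot v u)^*%C.
Proof. by rewrite (hermC hdot) /= expr0 mul1r. Qed.

Lemma hdotDl u v w : hdot (u + v) w = hdot u w + hdot v w.
Proof. by rewrite (linearDl hdot). Qed.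

Lemma hdotDr u v w : hdot u (v + w) = hdot u v + hdot u w.
Proof. by rewrite (linearDr hdot). Qed.

Lemma hdotZl c u v : hdot (c *: u) v = c * hdot u v.
Proof. by rewrite (linearZl_LR hdot). Qed.

Lemma hdotZr c u v : hdot u (c *: v) = c^*%C * hdot u v.
Proof. by rewrite (linearZr_LR hdot). Qed.

Lemma rdotC u v : rdot u v = rdot v u.
Proof. by rewrite /rdot hdotC; case: (hdot v u). Qed.

Lemma rdotDl u v w : rdot (u + v) w = rdot u w + rdot v w.
Proof. by rewrite /rdot hdotDl raddfD. Qed.

Lemma rdotDr u v w : rdot u (v + w) = rdot u v + rdot u w.
Proof. by rewrite /rdot hdotDr raddfD. Qed.

Lemma rdotZl t u v : rdot (t%:C *: u) v = t * rdot u v.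
Proof. by rewrite /rdot hdotZl; case: (hdot u v) => a b /=; simpc. Qed.

Lemma rdotZr t u v : rdot u (t%:C *: v) = t * rdot u v.
Proof. by rewrite rdotC rdotZl rdotC. Qed.

Lemma rdotNl u v : rdot (- u) v = - rdot u v.
Proof. by rewrite -scaleN1r -[in LHS](rmorphN1 (real_complex R)) rdotZl mulN1r. Qed.

Lemma rdotNr u v : rdot u (- v) = - rdot u v.
Proof. by rewrite rdotC rdotNl rdotC. Qed.

Lemma rdotxx u : rdot u u = rnorm u ^+ 2.
Proof. by rewrite /rdot hdot_norm normE -rmorphXn. Qed.

Lemma hdotxx u : hdot u u = (rnorm u ^+ 2)%:C.
Proof. by rewrite hdot_norm normE -rmorphXn. Qed.

Lemma rnormZ c u : rnorm (c *: u) = complex.Re `|c| * rnorm u.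
Proof.
apply: (@complexI R); rewrite -normE normrZ rmorphM.
by congr (_ * _); rewrite ?normE// -[LHS]RRe_real ?normr_real.
Qed.

Lemma rnorm_eq0 u : (rnorm u == 0) = (u == 0).
Proof. by rewrite -[RHS]normr_eq0 normE -(inj_eq (@complexI R)). Qed.

Lemma rnorm0 : rnorm (0 : H) = 0.
Proof. by apply/eqP; rewrite rnorm_eq0. Qed.

Lemma lt0cR t : (0 < t%:C) = (0 < t).
Proof. exact: (ltcR 0 t). Qed.

Lemma ltcR1 t : (t%:C < 1) = (t < 1).
Proof. exact: (ltcR t 1). Qed.

Lemma lecR1 t : (t%:C <= 1) = (t <= 1).
Proof. exact: (lecR t 1). Qed.

Lemma rdot_le u v : rdot u v <= rnorm u * rnorm v.
Proof.
rewrite -[leRHS]ger0_norm ?mulr_ge0 ?rnorm_ge0//.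
apply: le_trans (ler_norm _) _; rewrite -ler_sqr ?nnegrE//.
rewrite !real_normK ?num_real// exprMn -!rdotxx.
apply: discriminant_le0; last by rewrite rdotxx sqr_ge0.
move=> t; have -> : rdot u u + 2 * t * rdot u v + t ^+ 2 * rdot v v =
    rdot (u + t%:C *: v) (u + t%:C *: v).
  rewrite rdotDl !rdotDr !rdotZl !rdotZr (rdotC v u); ring.
by rewrite rdotxx sqr_ge0.
Qed.

Lemma rnormD u v : rnorm (u + v) <= rnorm u + rnorm v.
Proof. by rewrite -lecR rmorphD /= -!normE ler_normD. Qed.

End RealInnerProduct.

(** * Bounded and positive operators *)

Section BoundedOperators.
Variables (R : realType) (H : hilbertType R).
Implicit Types (u v w : H) (c : R[i]) (t : R) (T : H -> H).

Lemma bounded_opDE T u v : bounded_op T -> T (u + v) = T u + T v.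
Proof. by case=> lT _; have := lT 1 u v; rewrite !scale1r. Qed.

Lemma bounded_op0 T : bounded_op T -> T 0 = 0.
Proof.
move=> bT; apply: (@addrI _ (T 0)).
by rewrite -bounded_opDE// !addr0.
Qed.

Lemma bounded_opZE T c u : bounded_op T -> T (c *: u) = c *: T u.
Proof.
by move=> bT; have := bT.1 c u 0; rewrite (bounded_op0 bT) !addr0.
Qed.

Lemma bounded_op_bound T : bounded_op T ->
  exists2 M, 0 < M & forall u, rnorm (T u) <= M * rnorm u.
Proof.
move=> bT; have : T v @[v --> 0] --> T 0 := bT.2 0.
rewrite bounded_op0// => /cvgrPdist_lt /(_ 1 ltr01).
move=> /nbhs_ballP[d /= d_gt0 dT].
have [e de] : exists e : R, d = e%:C.
  by apply/complex_realP; exact: gtr0_real.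
have e_gt0 : 0 < e by move: d_gt0; rewrite de lt0cR.
exists (2 / e); first by rewrite divr_gt0.
move=> u; have [->|u0] := eqVneq u 0.
  by rewrite bounded_op0// !rnorm0 mulr0.
have nu_gt0 : 0 < rnorm u by rewrite lt_neqAle eq_sym rnorm_eq0 u0 rnorm_ge0.
pose s := e / 2 / rnorm u.
have s_gt0 : 0 < s by rewrite !divr_gt0.
have sR : complex.Re `|s%:C| = s by rewrite ger0_norm// ler0c ltW.
have : ball (0 : H) d (s%:C *: u).
  rewrite -ball_normE /ball_/= sub0r normrN de normE ltcR rnormZ sR.
  by rewrite /s divfK ?gt_eqF// gtr_pMr// invf_lt1// ltr1n.
move=> /dT/=; rewrite sub0r normrN normE ltcR1 bounded_opZE// rnormZ sR.
move=> /ltW sT; rewrite -(ler_pM2l s_gt0) (le_trans sT)//.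
by rewrite /s le_eqVlt; apply/orP; left; apply/eqP; field; rewrite ?gt_eqF.
Qed.

Lemma opnorm_le T u : bounded_op T -> rnorm u <= 1 -> rnorm (T u) <= opnorm T.
Proof.
move=> /bounded_op_bound[M M_gt0 bT] u1; apply: sup_upper_bound; last first.
  by exists u => //=; rewrite normE lecR1.
split; first by exists (rnorm (T u)); exists u; rewrite /= ?normE ?lecR1.
exists M => _ [v /= v1 <-]; rewrite (le_trans (bT v))// ler_piMr ?(ltW M_gt0)//.
by move: v1; rewrite normE lecR1.
Qed.

Lemma opnorm_ge0 T : bounded_op T -> 0 <= opnorm T.
Proof.
move=> bT; rewrite (le_trans (rnorm_ge0 (T 0)))// opnorm_le// rnorm0.
exact: ler01.
Qed.

Lemma opnorm_bound T u : bounded_op T -> rnorm (T u) <= opnorm T * rnorm u.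
Proof.
move=> bT; have [->|u0] := eqVneq u 0.
  by rewrite bounded_op0// !rnorm0 mulr0.
have nu_gt0 : 0 < rnorm u by rewrite lt_neqAle eq_sym rnorm_eq0 u0 rnorm_ge0.
have sR : complex.Re `|(rnorm u)^-1%:C| = (rnorm u)^-1.
  by rewrite ger0_norm// ler0c invr_ge0 ltW.
have := @opnorm_le T ((rnorm u)^-1%:C *: u) bT.
rewrite bounded_opZE// !rnormZ sR mulVf ?gt_eqF// => /(_ (lexx _)).
by rewrite mulrC ler_pdivrMr.
Qed.

Lemma opnorm_adherent T eps : bounded_op T -> 0 < eps ->
  exists2 u, rnorm u <= 1 & opnorm T - eps < rnorm (T u).
Proof.
move=> bT eps_gt0.
have [|_ [u /= u1 <-] Tu] := @sup_adherent R
    [set complex.Re `|T u| | u in [set u | `|u| <= 1]] eps eps_gt0.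
  split; first by exists (rnorm (T 0)); exists 0; rewrite /= ?normr0.
  exists (opnorm T) => _ [v /= v1 <-]; apply: opnorm_le => //.
  by move: v1; rewrite normE lecR1.
by exists u => //; move: u1; rewrite normE lecR1.
Qed.

(** Cauchy-Schwarz for the semidefinite form of a positive operator. *)
Lemma positive_op_CS T u v : bounded_op T -> adjoint_of T T -> positive_op T ->
  rdot (T u) v ^+ 2 <= rdot (T u) u * rdot (T v) v.
Proof.
move=> bT aT pT.
have q_ge0 w : 0 <= rdot (T w) w.
  by have := pT w; rewrite lecE => /andP[_].
apply: discriminant_le0 => // t.
have -> : rdot (T u) u + 2 * t * rdot (T u) v + t ^+ 2 * rdot (T v) v =
    rdot (T (u + t%:C *: v)) (u + t%:C *: v).
  rewrite bounded_opDE// bounded_opZE// rdotDl !rdotDr !rdotZl !rdotZr.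
  have -> : rdot (T v) u = rdot (T u) v by rewrite {1}/rdot aT -/(rdot _ _) rdotC.
  ring.
exact: q_ge0.
Qed.

Lemma positive_op_norm_le T u : bounded_op T -> adjoint_of T T -> positive_op T ->
  rnorm (T u) ^+ 2 <= opnorm T * rdot (T u) u.
Proof.
move=> bT aT pT.
have [->|Tu0] := eqVneq (T u) 0.
  by rewrite rnorm0 expr0n /= /rdot (linear0l hdot) mulr0.
have nTu : 0 < rnorm (T u) ^+ 2.
  by rewrite exprn_gt0// lt_neqAle eq_sym rnorm_eq0 Tu0 rnorm_ge0.
have := positive_op_CS u (T u) bT aT pT; rewrite rdotxx => CS.
rewrite -(ler_pM2r nTu) -expr2 (le_trans CS)//.
rewrite (mulrC (opnorm T)) -mulrA ler_wpM2l//.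
  by have := pT u; rewrite lecE => /andP[_].
rewrite (le_trans (rdot_le _ _))// expr2 mulrA ler_wpM2r ?rnorm_ge0//.
exact: opnorm_bound.
Qed.

Lemma rdot_op_le T u : bounded_op T -> rnorm u <= 1 -> rdot (T u) u <= opnorm T.
Proof.
move=> bT u1; rewrite (le_trans (rdot_le _ _))//.
rewrite -[leRHS]mulr1 ler_pM ?rnorm_ge0//; exact: opnorm_le.
Qed.

(** The norm of a positive operator is the supremum of its quadratic form. *)
Lemma positive_op_adherent T eps :
  bounded_op T -> adjoint_of T T -> positive_op T -> 0 < eps ->
  exists2 u, rnorm u <= 1 & opnorm T - eps <= rdot (T u) u.
Proof.
move=> bT aT pT eps_gt0.
have [N0|N_neq0] := eqVneq (opnorm T) 0.
  exists 0; first by rewrite rnorm0 ler01.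
  by rewrite N0 sub0r /rdot (linear0r hdot) oppr_le0 ltW.
have N_gt0 : 0 < opnorm T by rewrite lt_neqAle eq_sym N_neq0 opnorm_ge0.
have [|u u1 Tu] := @opnorm_adherent T (eps / 2) bT; first by rewrite divr_gt0.
exists u => //; rewrite -(ler_pM2l N_gt0).
rewrite (le_trans _ (positive_op_norm_le u bT aT pT))//.
move: (opnorm T) (rnorm (T u)) N_gt0 Tu => N r N_gt0 Tu.
(* [r ^+ 2 >= 2 * N * r - N ^+ 2 >= N * (N - eps)] *)
have := sqr_ge0 (N - r).
nra.
Qed.

End BoundedOperators.

(** * Compactness and the top eigenspace *)

Section Eigensphere.
Variables (R : realType) (H : hilbertType R).
Implicit Types (u v w : H) (c : R[i]) (t : R) (T : H -> H).

Lemma rnorm_continuous : continuous (@rnorm R H).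
Proof.
move=> u; apply/cvgrPdist_lt => e e_gt0.
have : nbhs u (ball u e%:C) by apply: nbhsx_ballx; rewrite lt0cR.
apply: filterS => v; rewrite -ball_normE /ball_/= normE ltcR; apply: le_lt_trans.
have := rnormD (u - v) v; have := rnormD (v - u) u; rewrite !subrK.
have -> : rnorm (v - u) = rnorm (u - v) by rewrite /rnorm distrC.
by rewrite ler_norml; lra.
Qed.

Lemma rdot_polarization u v :
  rdot u v = (rnorm (u + v) ^+ 2 - rnorm (u - v) ^+ 2) / 4.
Proof.
rewrite -!rdotxx !rdotDl !rdotDr !rdotNl !rdotNr (rdotC v u).
by field.
Qed.

Lemma continuous_rdot (f g : H -> H) : continuous f -> continuous g ->
  continuous (fun u => rdot (f u) (g u)).
Proof.
move=> cf cg.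
have cD v : {for v, continuous (fun u => rnorm (f u + g u))}.
  apply: (@continuous_comp _ _ _ (fun u => f u + g u)).
    by apply: cvgD; [exact: cf|exact: cg].
  exact: rnorm_continuous.
have cB v : {for v, continuous (fun u => rnorm (f u - g u))}.
  apply: (@continuous_comp _ _ _ (fun u => f u - g u)).
    by apply: cvgB; [exact: cf|exact: cg].
  exact: rnorm_continuous.
rewrite (_ : (fun u => _) = fun u =>
    (rnorm (f u + g u) ^+ 2 - rnorm (f u - g u) ^+ 2) / 4); last first.
  by apply/funext => u; exact: rdot_polarization.
move=> u; apply: cvgM; last exact: cvg_cst.
by apply: cvgB; (apply: cvgM; [|]); (exact: cD || exact: cB).
Qed.

(** The unit vectors of the eigenspace of [T] for the value [opnorm T], which is
    the top eigenvalue when [T] is positive, compact and nonzero. *)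
Definition top_eigensphere T u := rnorm u = 1 /\ T u = (opnorm T)%:C *: u.

Variable A : H -> H.
Hypotheses (kA : compact_op A) (m_gt0 : 0 < opnorm A).
Let m := opnorm A.
Let bA : bounded_op A := kA.1.

(** Near-maximizers of the quadratic form are approximate eigenvectors. *)
Lemma top_eigenvector_dist u : rnorm u <= 1 ->
  rnorm (A u - m%:C *: u) ^+ 2 <= 2 * m * (m - rdot (A u) u).
Proof.
move=> u1.
have -> : rnorm (A u - m%:C *: u) ^+ 2 =
    rnorm (A u) ^+ 2 - 2 * m * rdot (A u) u + m ^+ 2 * rnorm u ^+ 2.
  rewrite -!rdotxx !rdotDl !rdotDr !rdotNl !rdotNr !rdotZl !rdotZr (rdotC u (A u)).
  by ring.
have Au := opnorm_bound u bA.
have Au1 : rnorm (A u) <= m by rewrite (le_trans Au)// ler_piMr// ltW.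
have : rnorm (A u) ^+ 2 <= m ^+ 2 by rewrite ler_sqr ?nnegrE ?rnorm_ge0// ltW.
have : rnorm u ^+ 2 <= 1 by rewrite expr_le1// rnorm_ge0.
have m2 : 0 < m ^+ 2 by rewrite exprn_gt0.
rewrite -(ler_pM2l m2) mulr1; lra.
Qed.

(** If near-maximizers of the quadratic form of a compact operator nearly satisfy
    a closed condition [0 <= f u], then some vector of the top eigensphere
    satisfies it. *)
Lemma top_eigensphere_attained (f : H -> R) : continuous f ->
  (forall eps, 0 < eps ->
     exists u, [/\ rnorm u <= 1, m - eps <= rdot (A u) u & - eps <= f u]) ->
  exists2 u, top_eigensphere A u & 0 <= f u.
Proof.
move=> cf fA.
have /choice[u_ u_P] : forall n : nat, exists u,
    [/\ rnorm u <= 1, m - n.+1%:R^-1 <= rdot (A u) u & - n.+1%:R^-1 <= f u].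
  by move=> n; apply: fA; rewrite invr_gt0.
case: kA => _ [K AK [cK _]].
have [|p [_ pcl]] := cK ((fun n => A (u_ n)) @ \oo) _.
  exists 0%N => //= n _; apply: AK; exists (u_ n) => //=.
  by rewrite normE lecR1; case: (u_P n).
(* [A (u_ n)] clusters at [p] and [A (u_ n) - m u_ n] tends to 0, so that [u_ n]
   clusters at [p0] and closed conditions pass to [p0] *)
pose p0 := m^-1%:C *: p.
have pE : p = m%:C *: p0.
  by rewrite /p0 scalerA -rmorphM /= mulfV ?gt_eqF// scale1r.
have limit_ge0 (g : H -> R) : continuous g ->
    (forall n, - n.+1%:R^-1 <= g (u_ n)) -> 0 <= g p0.
  move=> cg gu; rewrite leNgt; apply/negP => g_lt0.
  have : \forall w \near p0, g w < g p0 / 2.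
    have : g w @[w --> p0] --> g p0 := cg p0.
    by move=> /cvgr_lt; apply; lra.
  move=> /nbhs_ballP[d /= d_gt0 dg].
  have [e de] : exists e : R, d = e%:C.
    by apply/complex_realP; exact: gtr0_real.
  have e_gt0 : 0 < e by move: d_gt0; rewrite de lt0cR.
  (* the second bound makes [A (u_ n) - m u_ n] shorter than [m * e / 2] *)
  have tol_gt0 : 0 < Num.min (- g p0 / 2) (m * e ^+ 2 / 8).
    by rewrite lt_min !divr_gt0 ?mulr_gt0 ?exprn_gt0// oppr_gt0.
  have [N _ NP] := near_infty_natSinv_lt (PosNum tol_gt0).
  have tailF : ((fun n => A (u_ n)) @ \oo)
      [set A (u_ n) | n in [set n | (N <= n)%N]].
    by exists N => // n /= Nn; exists n.
  have pball : nbhs p (ball p (m * e / 2)%:C).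
    by apply: nbhsx_ballx; rewrite lt0cR divr_gt0 ?mulr_gt0.
  have [_ [[n /= Nn <-] pAu]] := pcl _ _ tailF pball.
  have {NP}:= NP n Nn; rewrite /= lt_min => /andP[ng ne].
  have {}pAu : rnorm (p - A (u_ n)) < m * e / 2.
    by move: pAu; rewrite -ball_normE /ball_/= normE ltcR.
  have [u1 Au _] := u_P n.
  have uA : rnorm (A (u_ n) - m%:C *: u_ n) < m * e / 2.
    rewrite -ltr_sqr ?nnegrE ?rnorm_ge0 ?divr_ge0 ?mulr_ge0 ?ltW//.
    rewrite (le_lt_trans (top_eigenvector_dist u1))//.
    have m2 : 0 < 2 * m by rewrite mulr_gt0.
    have -> : (m * e / 2) ^+ 2 = 2 * m * (m * e ^+ 2 / 8) by field.
    by rewrite ltr_pM2l// (le_lt_trans _ ne)// lerBlDr -lerBlDl.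
  have : rnorm (m%:C *: (p0 - u_ n)) < m * e.
    have -> : m%:C *: (p0 - u_ n) = (p - A (u_ n)) + (A (u_ n) - m%:C *: u_ n).
      by rewrite scalerBr -pE addrA subrK.
    by rewrite (le_lt_trans (rnormD _ _))//; lra.
  rewrite rnormZ ger0_norm ?ler0c ?ltW//= ltr_pM2l// => pu.
  have : g (u_ n) < g p0 / 2.
    by apply: dg; rewrite -ball_normE /ball_/= normE de ltcR.
  by move: (gu n); move: (n.+1%:R^-1 : R) ng => s; lra.
have p01 : rnorm p0 <= 1.
  rewrite -subr_ge0; apply: (limit_ge0 (fun v => 1 - rnorm v)) => [v|n].
    by apply: cvgB; [exact: cvg_cst|exact: rnorm_continuous].
  by rewrite (@le_trans _ _ 0)// ?oppr_le0 ?invr_ge0// subr_ge0; case: (u_P n).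
have Ap0 : m <= rdot (A p0) p0.
  rewrite -subr_ge0; apply: (limit_ge0 (fun v => rdot (A v) v - m)) => [v|n].
    apply: cvgB; last exact: cvg_cst.
    by apply: continuous_rdot => [|w]; [exact: bA.2|exact: cvg_id].
  by rewrite lerBrDr addrC; case: (u_P n).
(* equality holds in Cauchy-Schwarz at [p0] *)
exists p0; last by apply: limit_ge0 => // n; case: (u_P n).
have eig : A p0 = m%:C *: p0.
  apply/eqP; rewrite -subr_eq0 -rnorm_eq0 -sqrf_eq0; apply/eqP/le_anti.
  rewrite sqr_ge0 andbT (le_trans (top_eigenvector_dist p01))//.
  by rewrite mulr_ge0_le0 ?subr_le0// mulr_ge0// ltW.
split=> //; apply/le_anti; rewrite p01/=.
have := rdot_le (A p0) p0; rewrite eig rnormZ ger0_norm ?ler0c ?(ltW m_gt0)//= => Ale.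
have {Ale}: m <= m * rnorm p0 * rnorm p0 by rewrite (le_trans _ Ale)// -eig.
by rewrite -mulrA ler_pMr// => nn; rewrite (le_trans nn)// ler_piMr ?rnorm_ge0.
Qed.

End Eigensphere.

(** * The numerical range on the top eigenspace *)

Section NumericalRange.
Variables (R : realType) (H : hilbertType R).
Implicit Types (u v w : H) (c : R[i]) (t : R) (T : H -> H).

(** The squared modulus of a complex number, as a real number. *)
Definition sqmod c : R := complex.Re c ^+ 2 + complex.Im c ^+ 2.

Lemma sqmodM c1 c2 : sqmod (c1 * c2) = sqmod c1 * sqmod c2.
Proof. by case: c1 c2 => [a b] [a' b']; rewrite /sqmod /=; ring. Qed.

Lemma sqmod_ge0 c : 0 <= sqmod c.
Proof. by rewrite addr_ge0 ?sqr_ge0. Qed.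

Lemma sqmod_eq0 c : (sqmod c == 0) = (c == 0).
Proof. by rewrite paddr_eq0 ?sqr_ge0// !sqrf_eq0 eq_complex. Qed.

Lemma sqmodR t : sqmod t%:C = t ^+ 2.
Proof. by rewrite /sqmod /= expr0n addr0. Qed.

Lemma continuous_sqmod_quadratic T : bounded_op T ->
  continuous (fun u => sqmod (hdot (T u) u)).
Proof.
move=> bT; rewrite (_ : (fun u => _) =
    (fun u => rdot (T u) u ^+ 2 + rdot (('i%C *: T) u) u ^+ 2)); last first.
  apply/funext => u; rewrite /sqmod /rdot hdotZl.
  by case: (hdot (T u) u) => a b /=; ring.
have cid : continuous (fun u : H => u) by move=> w; exact: cvg_id.
move=> u; apply: cvgD; apply: cvgM; apply: continuous_rdot => //;
  try exact: bT.2; exact: (bounded_opZ _ bT).2.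
Qed.

(** A nonzero factor making a sesquilinear cross term real. *)
Lemma real_cross_term (p q : R[i]) :
  exists2 s : R[i], s != 0 & complex.Im (s * p + s^*%C * q) = 0.
Proof.
have [e|ne] := eqVneq p q^*%C.
  by exists 1; rewrite ?oner_neq0// e; case: q {e} => a b /=; ring.
exists (p - q^*%C)^*%C; first by rewrite conjc_eq0 subr_eq0.
by case: p {ne} => a b; case: q => a' b' /=; ring.
Qed.

Variables (A B : H -> H).
Hypotheses (kA : compact_op A) (m_gt0 : 0 < opnorm A).
Hypothesis bB : bounded_op B.
Let m := opnorm A.
Let bA : bounded_op A := kA.1.

Lemma rdot_top_eigensphere u : top_eigensphere A u -> rdot (A u) u = m.
Proof. by move=> [u1 ->]; rewrite rdotZl rdotxx u1 expr1n mulr1. Qed.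

(** The infimum is attained: it is within [eps] of the value at some vector of the
    eigensphere, and [inf - |<B u, u>| ^ 2 >= 0] is a closed condition. *)
Lemma min_sqmod_top_eigensphere : (exists u, top_eigensphere A u) ->
  exists2 u, top_eigensphere A u &
    forall v, top_eigensphere A v ->
      sqmod (hdot (B u) u) <= sqmod (hdot (B v) v).
Proof.
move=> [w Sw]; pose W := [set sqmod (hdot (B u) u) | u in top_eigensphere A].
have Winf : has_inf W.
  split; first by exists (sqmod (hdot (B w) w)), w.
  by exists 0 => _ [v _ <-]; exact: sqmod_ge0.
have [|eps eps_gt0|u Su uW] := @top_eigensphere_attained _ _ A kA m_gt0
    (fun u => inf W - sqmod (hdot (B u) u)).
- by move=> u; apply: cvgB; [exact: cvg_cst|exact: continuous_sqmod_quadratic].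
- have [_ [v Sv <-] vW] := inf_adherent eps_gt0 Winf.
  exists v; split; first by case: Sv => ->.
    by rewrite rdot_top_eigensphere// lerBlDr lerDl ltW.
  by rewrite lerBrDr -lerBrDl opprK ltW// addrC.
exists u => // v Sv; rewrite subr_ge0 in uW; rewrite (le_trans uW)//.
by apply: ge_inf; [exact: Winf.2|exists v].
Qed.

(** The numerical range of [B] on the top eigenspace of [A] contains 0 as soon
    as it meets every closed half-plane through 0: a point of least modulus
    which is not 0 could be moved closer to 0. *)
Lemma numerical_range_top_eigensphere0 :
  (forall c, exists2 u, top_eigensphere A u &
     0 <= complex.Re (c * hdot (B u) u)) ->
  exists2 u, top_eigensphere A u & hdot (B u) u = 0.
Proof.
move=> half; have [|u0 Su0 u0_min] := min_sqmod_top_eigensphere.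
  by have [w Sw _] := half 0; exists w.
exists u0 => //; apply/eqP/negPn/negP => w0_neq0.
pose w0 := hdot (B u0) u0; rewrite -/w0 in w0_neq0.
have sq0_gt0 : 0 < sqmod w0 by rewrite lt_neqAle eq_sym sqmod_eq0 w0_neq0 sqmod_ge0.
have min_eig z : A z = m%:C *: z -> rnorm z ^+ 4 <= sqmod (w0^-1 * hdot (B z) z).
  move=> Az; have [->|z0] := eqVneq z 0; first by rewrite rnorm0 expr0n sqmod_ge0.
  have n_gt0 : 0 < rnorm z by rewrite lt_neqAle eq_sym rnorm_eq0 z0 rnorm_ge0.
  pose r := (rnorm z)^-1.
  have r_gt0 : 0 < r by rewrite invr_gt0.
  have Sz : top_eigensphere A (r%:C *: z).
    split; first by rewrite rnormZ ger0_norm ?ler0c ?(ltW r_gt0)//= mulVf ?gt_eqF.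
    by rewrite bounded_opZE// Az scalerA mulrC -scalerA.
  have := u0_min _ Sz; rewrite bounded_opZE// hdotZl hdotZr conjc_real mulrA.
  rewrite sqmodM -rmorphM sqmodR -/w0 => le.
  rewrite -(ler_pM2l sq0_gt0) -sqmodM mulVKf//.
  have -> : rnorm z ^+ 4 = (r * r) ^- 2 by rewrite /r; field; rewrite gt_eqF.
  by rewrite ler_pdivrMr ?exprn_gt0 ?mulr_gt0// mulrC.
(* a vector whose value lies in the half-plane opposite to [w0] *)
have [v Sv v_half] := half (- w0^-1).
pose p := w0^-1 * hdot (B v) u0; pose q := w0^-1 * hdot (B u0) v.
have [s s0 im0] := real_cross_term p q.
pose bv := w0^-1 * hdot (B v) v.
have ka_gt0 : 0 < sqmod s by rewrite lt_neqAle eq_sym sqmod_eq0 s0 sqmod_ge0.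
have bv_le0 : sqmod s * complex.Re bv <= 0.
  rewrite pmulr_rle0// -oppr_ge0; move: v_half; rewrite mulNr -/bv.
  by case: (bv).
(* along [u0 + t s v], the value divided by [w0] and the squared norm are
   quadratic in [t] *)
have [t] := @perturbed_square_lt R (complex.Re (s * p + s^*%C * q))
  (2 * complex.Re (s * hdot v u0)) _ _ (sqmod s * complex.Im bv) ka_gt0 bv_le0.
apply/negP; rewrite -leNgt.
pose z := u0 + (t%:C * s) *: v.
have Az : A z = m%:C *: z.
  rewrite bounded_opDE// bounded_opZE// scalerDr.
  by case: Su0 => _ ->; case: Sv => _ ->; rewrite !scalerA mulrC.
have := min_eig z Az.
have -> : w0^-1 * hdot (B z) z =
    1 + t%:C * (s * p + s^*%C * q) + (t ^+ 2)%:C * (s * s^*%C) * bv.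
  rewrite bounded_opDE// bounded_opZE// !(hdotDl,hdotDr) !(hdotZl,hdotZr).
  have -> : (t%:C * s)^*%C = t%:C * s^*%C.
    by case: (s) => a b; simpc.
  rewrite (rmorphXn (real_complex R)) -/w0 -[X in _ = X + _ + _](mulVf w0_neq0).
  by rewrite /p /q /bv; ring.
have -> : rnorm z ^+ 4 =
    (1 + t * (2 * complex.Re (s * hdot v u0)) + t ^+ 2 * sqmod s) ^+ 2.
  rewrite (exprM _ 2 2); congr (_ ^+ 2).
  have -> : rnorm z ^+ 2 = complex.Re (hdot z z) by rewrite hdotxx.
  rewrite !(hdotDl,hdotDr) !(hdotZl,hdotZr) !hdotxx.
  case: Su0 => -> _; case: Sv => -> _; rewrite (hdotC u0 v).
  by case: (s) => a b; case: (hdot v u0) => a' b'; rewrite /sqmod /=; ring.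
move: im0; rewrite /sqmod.
case: (s * p + _) => a b /= ->; case: (s) => a' b'; case: (bv) => a2 b2 /=.
move=> le; rewrite (le_trans le)// le_eqVlt; apply/orP; left; apply/eqP.
ring.
Qed.

End NumericalRange.

(** * Parseval's identity and rank one operators *)

Section Parseval.
Variables (R : realType) (H : hilbertType R).
#[local] Existing Instance summability.totally_filter.
Implicit Types (u v w : H) (c : R[i]) (t : R).

Lemma norm_sqmod c : complex.Re `|c| ^+ 2 = sqmod c.
Proof.
by rewrite normc_def /= sqr_sqrtr// addr_ge0 ?sqr_ge0.
Qed.

Lemma norm_hdot_le u v : `|hdot u v| <= (rnorm u * rnorm v)%:C.
Proof.
rewrite -[leLHS]RRe_real ?normr_real// lecR.
pose c := (hdot u v)^*%C.
have cE : `|c| = `|hdot u v| by rewrite normcJ.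
have [->|n0] := eqVneq (hdot u v) 0; first by rewrite normr0 mulr_ge0 ?rnorm_ge0.
have n_gt0 : 0 < complex.Re `|hdot u v|.
  by rewrite -lt0cR RRe_real ?normr_real// normr_gt0.
rewrite -(ler_pM2l n_gt0) -expr2 norm_sqmod.
have -> : sqmod (hdot u v) = rdot (c *: u) v.
  by rewrite /rdot hdotZl /c; case: (hdot u v) => a b; rewrite /sqmod /=; ring.
by rewrite (le_trans (rdot_le _ _))// rnormZ cE mulrA.
Qed.

Lemma cvg_hdotl (T : Type) (F : set_system T) (FF : Filter F) (f : T -> H) l w :
  f x @[x --> F] --> l -> (hdot (f x) w : R[i]^o) @[x --> F] --> (hdot l w : R[i]^o).
Proof.
move=> fl; apply/cvgrPdist_lt => e e_gt0.
have n1_gt0 : 0 < (rnorm w + 1)%:C by rewrite lt0cR ltr_wpDl ?rnorm_ge0.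
have /cvgrPdist_lt/(_ (e / (rnorm w + 1)%:C)) := fl.
rewrite divr_gt0// => /(_ isT); apply: filterS => x.
rewrite ltr_pdivlMr// => lt; rewrite -(linearBl hdot).
apply: le_lt_trans (norm_hdot_le _ _) (le_lt_trans _ lt).
by rewrite normE -rmorphM lecR ler_wpM2l ?rnorm_ge0// lerDl.
Qed.

Section Bessel.
Variables (I : choiceType) (e : I -> H).
Implicit Types (s : seq I).

(** The orthogonal projection of [v] on the span of the [e i], for [i] in [s],
    when these vectors are orthonormal. *)
Definition oproj s v : H := \sum_(i <- s) hdot v (e i) *: e i.

Lemma hdot_oproj s v w :
  hdot (oproj s v) w = \sum_(i <- s) hdot v (e i) * hdot (e i) w.
Proof.
rewrite /oproj; elim: s => [|i s IH]; first by rewrite !big_nil (linear0l hdot).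
by rewrite !big_cons hdotDl hdotZl IH.
Qed.

(** The [e i] with [i] in [s] are orthonormal; in particular [e] is injective on
    [s]. *)
Definition orthonormal_on s :=
  {in s &, forall i j, hdot (e i) (e j) = (i == j)%:R}.

Lemma hdot_oproj_basis s v j : uniq s -> orthonormal_on s -> j \in s ->
  hdot (oproj s v) (e j) = hdot v (e j).
Proof.
move=> us on js; rewrite hdot_oproj (bigD1_seq j)//= on// eqxx mulr1.
rewrite big_seq_cond big1 ?addr0// => i /andP[is_ ij].
by rewrite on// (negbTE ij) mulr0.
Qed.

Lemma hdot_oproj_self s v :
  hdot (oproj s v) v = (\sum_(i <- s) sqmod (hdot v (e i)))%:C.
Proof.
rewrite hdot_oproj rmorph_sum; apply: eq_bigr => i _.
rewrite (hdotC (e i)); case: (hdot v (e i)) => a b.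
by rewrite /sqmod; simpc; congr (_ +i* _); ring.
Qed.

(** Projections on nested spans satisfy [<P1 v, P2 v> = <P1 v, v>]. *)
Lemma hdot_oproj_sub s1 s2 v : uniq s2 -> orthonormal_on s2 ->
  {subset s1 <= s2} ->
  hdot (oproj s1 v) (oproj s2 v) = (\sum_(i <- s1) sqmod (hdot v (e i)))%:C.
Proof.
move=> us on s12; rewrite -hdot_oproj_self !hdot_oproj big_seq [RHS]big_seq.
apply: eq_bigr => i /s12 is_.
by rewrite (hdotC (e i)) hdot_oproj_basis// -hdotC.
Qed.

Lemma rnorm_oproj s v : uniq s -> orthonormal_on s ->
  rnorm (oproj s v) ^+ 2 = \sum_(i <- s) sqmod (hdot v (e i)).
Proof.
by move=> us on; apply: (@complexI R); rewrite -hdotxx hdot_oproj_sub.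
Qed.

Lemma bessel s v : uniq s -> orthonormal_on s ->
  \sum_(i <- s) sqmod (hdot v (e i)) <= rnorm v ^+ 2.
Proof.
move=> us on; rewrite -rnorm_oproj//.
have : rnorm (oproj s v) ^+ 2 <= rnorm (oproj s v) * rnorm v.
  rewrite (le_trans _ (rdot_le _ _))// rnorm_oproj// /rdot.
  by rewrite hdot_oproj_self.
have := rnorm_ge0 v; have := rnorm_ge0 (oproj s v).
by move: (rnorm _) (rnorm v) => a b; nra.
Qed.

End Bessel.

(** Bessel's inequality makes the net of finite partial sums Cauchy; its limit
    has the same coefficients as [v]. *)
Lemma cvg_oproj (E : set H) v : orthonormal_basis E ->
  oproj (fun i : E => val i) (F : seq E) v @[F --> @summability.totally E] --> v.
Proof.
move=> [onE totE].
pose e (i : E) : H := val i.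
have on (F : {fset E}) : orthonormal_on e F.
  by move=> i j _ _; rewrite onE ?(inj_eq val_inj)//; exact: set_valP.
have sub (F G : {fset E}) : (F `<=` G)%fset ->
    rnorm (oproj e G v - oproj e F v) ^+ 2 =
    rnorm (oproj e G v) ^+ 2 - rnorm (oproj e F v) ^+ 2.
  move=> FG.
  have s12 : {subset F <= G} by move=> i; exact: (fsubsetP FG).
  have sP : rdot (oproj e F v) (oproj e G v) = rnorm (oproj e F v) ^+ 2.
    rewrite /rdot hdot_oproj_sub ?fset_uniq ?rnorm_oproj ?fset_uniq//.
  by rewrite -!rdotxx rdotDl !rdotDr !rdotNl !rdotNr (rdotC (oproj e G v)) sP
    -rdotxx; ring.
pose S := [set rnorm (oproj e (F : seq E) v) ^+ 2 | F in [set: {fset E}]].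
have Ssup : has_sup S.
  split; first by exists (rnorm (oproj e (fset0 : {fset E}) v) ^+ 2), fset0.
  by exists (rnorm v ^+ 2) => _ [F _ <-]; rewrite rnorm_oproj ?fset_uniq// bessel ?fset_uniq.
pose f (F : {fset E}) := oproj e (F : seq E) v.
have /cauchy_cvgP cvf : cauchy (f F @[F --> @summability.totally E]).
  apply/cauchyP => d d_gt0.
  have [r dr] : exists r : R, d = r%:C.
    by apply/complex_realP; exact: gtr0_real.
  have r_gt0 : 0 < r by move: d_gt0; rewrite dr lt0cR.
  have r2_gt0 : 0 < r ^+ 2 by rewrite exprn_gt0.
  have [_ [F _ <-] SF] := sup_adherent r2_gt0 Ssup.
  exists (f F); exists F => // G /= FG.
  rewrite -ball_normE /ball_/= distrC normE dr ltcR -ltr_sqr ?nnegrE ?rnorm_ge0 ?(ltW r_gt0)//.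
  rewrite sub// ltrBlDr -ltrBlDl (le_lt_trans _ SF)// lerB//.
  by apply: sup_upper_bound => //; exists G.
have : f F @[F --> @summability.totally E] --> lim (f F @[F --> @summability.totally E]).
  exact: cvf.
suff -> : lim (f F @[F --> @summability.totally E]) = v by [].
apply/eqP; rewrite -subr_eq0; apply/eqP; apply: totE => a Ea.
rewrite (linearBl hdot); apply/eqP; rewrite subr_eq0; apply/eqP.
pose j : E := SigSub (mem_set Ea).
apply: (@cvg_unique R[i]^o _ _ _ _ _ (@cvg_hdotl _ _ _ f _ a cvf)).
  exact: norm_hausdorff.
apply: cvg_near_cst.
exists [fset j]%fset => // G /= jG.
have -> : a = e j by [].
apply: hdot_oproj_basis => //; rewrite ?fset_uniq//.
by apply: (fsubsetP jG); rewrite inE.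
Qed.

(** Parseval's identity, as a formula for the trace. *)
Lemma optrace_parseval (T : H -> H) v w :
  (forall a, hdot (T a) a = hdot v a * hdot a w) -> optrace T = hdot v w.
Proof.
move=> TE; rewrite /optrace /summability.sum.
set f := summability.partial_sum _; set F := summability.totally.
have cvf : f @ F --> (hdot v w : R[i]^o).
  rewrite (_ : f = fun F : {fset @hbasis R H} =>
      hdot (oproj (fun i : @hbasis R H => val i) (F : seq _) v) w); last first.
    apply/funext => G; rewrite hdot_oproj /f /summability.partial_sum.
    by rewrite big_seq_fsetE; apply: eq_bigr => i _; exact: TE.
  apply: cvg_hdotl; apply: cvg_oproj.
  exact: (projT2 (cid (exists_orthonormal_basis H))).
by apply: (@cvg_lim R[i]^o _ _ F _ f (hdot v w) cvf); exact: norm_hausdorff.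
Qed.

(** The rank one operator [<., u> u]; for a unit vector [u], the orthogonal
    projection on the line of [u]. *)
Definition rank_one u : H -> H := fun v => hdot v u *: u.

Lemma rank_one_bounded u : bounded_op (rank_one u).
Proof.
split.
  by move=> c v w; rewrite /rank_one hdotDl hdotZl scalerDl scalerA.
move=> v; apply: (@cvgZr_tmp R[i]).
by apply: cvg_hdotl; exact: cvg_id.
Qed.

Lemma rank_one_adjoint u : adjoint_of (rank_one u) (rank_one u).
Proof.
by move=> v w; rewrite /rank_one hdotZl hdotZr (hdotC u w) mulrC.
Qed.

Lemma rank_one_positive u : positive_op (rank_one u).
Proof.
by move=> v; rewrite /rank_one hdotZl (hdotC u v) mulcJ_ge0.
Qed.

Lemma rank_one_trace_class u : trace_class (rank_one u).
Proof.
split; first exact: rank_one_bounded.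
exists (rank_one u).
  split; [exact: rank_one_bounded|exact: rank_one_positive|].
  by exists (rank_one u) => //; exact: rank_one_adjoint.
rewrite (@le_lt_trans _ _ (rnorm u ^+ 2)%:E)%E ?ltry//.
apply: ub_ereal_sup => _ [F [finF FE] <-].
rewrite fsbig_finite//= sumEFin lee_fin.
rewrite (eq_bigr (fun a => sqmod (hdot u a))) => [|a _]; last first.
  rewrite /rank_one hdotZl (hdotC a u).
  by case: (hdot u a) => x y; rewrite /sqmod /=; ring.
have [onE _] := projT2 (cid (exists_orthonormal_basis H)).
apply: (@bessel H id); first exact: fset_uniq.
by move=> a b /[!in_fset_set]// /set_mem/FE Ea /set_mem/FE Eb; exact: onE.
Qed.

(** [tr (<., u> u T) = <T u, u>] when [T] is self-adjoint. *)
Lemma optrace_rank_one u T : adjoint_of T T ->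
  optrace (rank_one u \o T) = hdot (T u) u.
Proof.
move=> aT; rewrite aT; apply: optrace_parseval => a.
by rewrite /rank_one /= hdotZl mulrC aT.
Qed.

End Parseval.

(** * Hilbert modules *)

Section HilbertModule.
Variables (R : realType) (H : hilbertType R) (V : hilbertKModule H).
Implicit Types (x y z : V) (u : H) (c : R[i]) (t : R).

(** The sesquilinear form on [V] induced by the vector functional of [u]. *)
Definition vform u x y : R[i] := hdot (vdot x y u) u.

Lemma vdot_bounded x y : bounded_op (vdot x y).
Proof. exact: (compactOpP (vdot x y)).1. Qed.

Lemma vformC u x y : vform u y x = (vform u x y)^*%C.
Proof. by rewrite /vform vdotC hdotC. Qed.

Lemma vformDr u x y z : vform u x (y + z) = vform u x y + vform u x z.
Proof. by rewrite /vform vdotD -hdotDl. Qed.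

Lemma vformZr u x c y : vform u x (c *: y) = c * vform u x y.
Proof. by rewrite /vform vdotZ -hdotZl. Qed.

Lemma vform_ge0 u x : 0 <= vform u x x.
Proof. exact: vdot_ge0. Qed.

Lemma vform0r u x : vform u x 0 = 0.
Proof. by rewrite -(scale0r (0 : V)) vformZr mul0r. Qed.

Lemma vform_line u x y c : vform u (x + c *: y) (x + c *: y) =
  vform u x x + (c * vform u x y + (c * vform u x y)^*%C) +
  (sqmod c)%:C * vform u y y.
Proof.
have yy : vform u y y = (complex.Re (vform u y y))%:C.
  by rewrite RRe_real// ger0_real// vform_ge0.
have xx : vform u x x = (complex.Re (vform u x x))%:C.
  by rewrite RRe_real// ger0_real// vform_ge0.
rewrite vformDr vformZr (vformC u x) (vformC u y (x + _)) !vformDr !vformZr.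
rewrite (vformC u x y) yy xx.
case: (c) => a b; case: (vform u x y) => p q; rewrite /sqmod; simpc.
by congr (_ +i* _); rewrite /=; ring.
Qed.

Lemma norm_opnorm x : complex.Re `|x| ^+ 2 = opnorm (vdot x x).
Proof. by rewrite vdot_norm/= sqr_sqrtr// opnorm_ge0//; exact: vdot_bounded. Qed.

Lemma norm_sqE x : `|x| ^+ 2 = (opnorm (vdot x x))%:C.
Proof.
by rewrite -norm_opnorm -[in LHS](RRe_real (normr_real x)) -rmorphXn.
Qed.

Lemma vform_le u x : rnorm u <= 1 -> complex.Re (vform u x x) <= opnorm (vdot x x).
Proof. by move=> u1; apply: rdot_op_le => //; exact: vdot_bounded. Qed.

(** Birkhoff-James orthogonality, tested along the ray of [c], yields a top
    eigenvector [u] of [<x, x>] with [Re (c <<x, y> u, u>) >= 0]. *)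
Lemma birkhoff_james_top_eigenvector x y c : x != 0 -> birkhoff_james x y ->
  exists2 u, top_eigensphere (vdot x x) u & 0 <= complex.Re (c * vform u x y).
Proof.
move=> x0 xy; pose m := opnorm (vdot x x).
have m_gt0 : 0 < m.
  by rewrite -lt0cR -norm_sqE exprn_gt0// normr_gt0.
have bB : bounded_op (c *: (vdot x y : H -> H)) by apply/bounded_opZ/vdot_bounded.
pose f u := rdot ((c *: (vdot x y : H -> H)) u) u.
have fE u : complex.Re (c * vform u x y) = f u by rewrite /f /rdot hdotZl.
have [|eps eps_gt0|u Su fu] :=
    @top_eigensphere_attained _ _ _ (compactOpP (vdot x x)) m_gt0 f; last 1 first.
- by exists u => //; rewrite fE.
- apply: continuous_rdot => [|v]; [exact: bB.2|exact: cvg_id].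
pose M := opnorm (c *: (vdot x y : H -> H)).
pose d := sqmod c * opnorm (vdot y y).
have M_ge0 : 0 <= M := opnorm_ge0 bB.
have d_ge0 : 0 <= d by rewrite mulr_ge0 ?sqmod_ge0// opnorm_ge0//; exact: vdot_bounded.
(* [D] collects the first-order losses, so that a step [t <= eps / D] costs at
   most [eps] *)
pose D := 1 + 2 * M + d.
have D_gt0 : 0 < D by rewrite /D; lra.
pose t := Num.min 1 (eps / D).
have t_gt0 : 0 < t by rewrite lt_min ltr01 divr_gt0.
have t1 : t <= 1 by rewrite ge_min lexx.
have tD : t * D <= eps by rewrite -ler_pdivlMr// ge_min lexx orbT.
pose z := x + (t%:C * c) *: y.
have zm : m <= opnorm (vdot z z).
  rewrite -lecR -!norm_sqE lerXn2r ?nnegrE//; exact: xy.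
have t2_gt0 : 0 < t ^+ 2 by rewrite exprn_gt0.
have [u u1] := positive_op_adherent (vdot_bounded z z) (vdotC z z) (vdot_ge0 z) t2_gt0.
rewrite -[rdot _ _]/(complex.Re (vform u z z)) vform_line => zu.
have {zu} : m - t ^+ 2 <=
    rdot (vdot x x u) u + 2 * t * f u + t ^+ 2 * (sqmod c * complex.Re (vform u y y)).
  rewrite (le_trans (lerB zm (lexx _)))// (le_trans zu)// le_eqVlt; apply/orP; left.
  rewrite -fE sqmodM sqmodR -mulrA raddfD /= raddfD /= -[rdot _ _]/(complex.Re (vform u x x)).
  case: (c * vform u x y) => p q; case: (vform u y y) => p' q'.
  by apply/eqP; rewrite /=; ring.
have xu : rdot (vdot x x u) u <= m := vform_le x u1.
have yu : sqmod c * complex.Re (vform u y y) <= d.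
  by rewrite ler_wpM2l ?sqmod_ge0// vform_le.
have fM : f u <= M := rdot_op_le bB u1.
move=> main; suff : m - eps <= rdot (vdot x x u) u /\ - eps <= f u by case; exists u.
move: (sqmod c * _) yu (f u) fM (rdot _ _) xu main => q qd g gM a am main.
have {}main : m - t ^+ 2 <= a + 2 * t * g + t ^+ 2 * d.
  by rewrite (le_trans main)// lerD2l ler_pM2l.
have t2 : t ^+ 2 <= t by rewrite expr2 ler_piMl// ltW.
have tM : 0 <= t * M by rewrite mulr_ge0// ltW.
rewrite /D in tD; split.
  have tg : t * g <= t * M by rewrite ler_pM2l.
  have td : t ^+ 2 * d <= t * d by rewrite ler_wpM2r.
  lra.
have : 0 <= t * (2 * g + t * (1 + d)) by lra.
by rewrite pmulr_rge0//; lra.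
Qed.

End HilbertModule.

Theorem theorem2p1 (R : realType) (H : hilbertType R)
    (H_neq0 : exists u : H, u != 0) (V : hilbertKModule H) (x y : V) :
  birkhoff_james x y <->
  exists P : H -> H,
    [/\ trace_class P, positive_op P, optrace P = 1 &
        forall c : R[i],
          `|x + c *: y| ^+ 2 >=
            `|x| ^+ 2 + `|c| ^+ 2 * optrace (P \o vdot y y)].
Proof.
have nE (z : V) : `|z| = (complex.Re `|z|)%:C by rewrite RRe_real ?normr_real.
have cE (c : R[i]) : `|c| ^+ 2 = (sqmod c)%:C.
  by rewrite -norm_sqmod -[in LHS](RRe_real (normr_real c)) -rmorphXn.
split=> [xy|[P [_ _ _ P_le]] c].
  have [u [u1 xu xyu]] : exists u, [/\ rnorm u = 1,
      vform u x x = `|x| ^+ 2 & vform u x y = 0].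
    have [x0|x_neq0] := eqVneq x 0.
      have [v v0] := H_neq0; exists ((rnorm v)^-1%:C *: v).
      have nv_gt0 : 0 < rnorm v by rewrite lt_neqAle eq_sym rnorm_eq0 v0 rnorm_ge0.
      rewrite x0 normr0 expr0n vform0r vformC vform0r conjc0; split=> //.
      rewrite rnormZ ger0_norm ?ler0c ?invr_ge0 ?(ltW nv_gt0)//=.
      by rewrite mulVf ?gt_eqF.
    have m_gt0 : 0 < opnorm (vdot x x).
      by rewrite -lt0cR -norm_sqE exprn_gt0// normr_gt0.
    have [|u [u1 xu] xyu] := numerical_range_top_eigensphere0
        (compactOpP (vdot x x)) m_gt0 (vdot_bounded x y).
      by move=> c; exact: birkhoff_james_top_eigenvector.
    exists u; split => //.
    by rewrite /vform xu hdotZl hdotxx u1 expr1n mulr1 -norm_sqE.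
  exists (rank_one u); split.
  - exact: rank_one_trace_class.
  - exact: rank_one_positive.
  - have -> : rank_one u = rank_one u \o id by [].
    by rewrite optrace_rank_one// hdotxx u1 expr1n.
  move=> c; rewrite optrace_rank_one; last exact: vdotC.
  rewrite cE.
  have -> : `|x| ^+ 2 + (sqmod c)%:C * hdot (vdot y y u) u =
      vform u (x + c *: y) (x + c *: y).
    by rewrite vform_line xu xyu mulr0 conjc0 !addr0.
  rewrite norm_sqE -(RRe_real (ger0_real (vform_ge0 _ _))) lecR.
  by rewrite vform_le// u1.
rewrite nE [leRHS]nE lecR.
apply: (@convex_slope R _ _ (sqmod c * complex.Re (optrace (P \o vdot y y)))
  (fun s => complex.Re `|x + (s%:C * c) *: y|)).
- by rewrite -ler0c -nE.
- by rewrite -ler0c -nE.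
- by move=> s _ _; rewrite -ler0c -nE.
- move=> s s_gt0 s1; rewrite -lecR rmorphD /= !rmorphM /= -!nE.
  have -> : x + (s%:C * c) *: y = (1 - s)%:C *: x + s%:C *: (x + c *: y).
    by rewrite scalerDr scalerA addrA -scalerDl -rmorphD /= subrK scale1r.
  rewrite (le_trans (ler_normD _ _))// !normrZ !ger0_norm// ler0c ?subr_ge0//.
  exact: ltW.
- move=> s s_gt0 s1; have := P_le (s%:C * c).
  rewrite cE (nE x) (nE (x + _)) -!rmorphXn lecE => /andP[_].
  rewrite sqmodM sqmodR raddfD /=.
  case: (optrace _) => p q /=.
  by rewrite mul0r subr0 mulrA.
Qed.
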